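(* Let $I \subseteq \mathbb{R}$ be an interval (possibly infinite). (1) Let $\phi : I \to \mathbb{R}$ be a convex function. Then for all $a, b, c \in I$ such that either $c \leq a$ and $c \leq b$, or $c \geq a$ and $c \geq b$, and such that $a+b-c \in I$, we have $$\phi(a)+\phi(b) \leq \phi(c)+\phi(a+b-c).$$ (2) Let $\phi : I \to \mathbb{R}$ be a function that is bounded above on some single (nondegenerate) interval contained in $I$. Then $\phi$ is convex if and only if the inequality $$\phi(a)+\phi(b) \leq \phi(c)+\phi(a+b-c)$$ holds for all $a,b,c \in I$ with $a+b-c \in I$ and such that either ($c \leq a$ and $c \leq b$) or ($c \geq a$ and $c \geq b$).
   Context: A function $\phi : I \to \mathbb{R}$ on an interval $I$ is convex if $\phi(\lambda x + (1-\lambda) y) \leq \lambda \phi(x) + (1-\lambda)\phi(y)$ for all $x,y \in I$ and $0 \leq \lambda \leq 1$. *)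

(* Defs.v *)
From mathcomp Require Import all_boot all_order all_algebra.
From mathcomp Require Import all_classical all_reals all_analysis.

Set Implicit Arguments.
Unset Strict Implicit.
Unset Printing Implicit Defensive.

Import Order.TTheory GRing.Theory Num.Theory.

Local Open Scope classical_set_scope.
Local Open Scope ring_scope.

(* A function on a subset D of R is represented by a total function R -> R of
   which only the values on D matter.  The line R is the left module R^o over
   itself: for x, y in D and t in [0, 1], [convex_function D phi] states
   phi (t * x + (1 - t) * y) <= t * phi x + (1 - t) * phi y. *)
Definition convex_on (R : realType) (D : set R) (phi : R -> R) : Prop :=
  @convex_function R R^o D phi.

Definition nondegenerate_interval (R : realType) (J : set R) : Prop :=
  is_interval J /\ exists x y : R, [/\ J x, J y & x < y].

Definition bounded_above_on (R : realType) (J : set R) (phi : R -> R) : Prop :=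
  has_ubound (phi @` J).

(* Main.v *)
(* For the converse, the inequality with c = x and a + b - c = q transports a
   bound from a nondegenerate segment [p, q] to the left: if x <= p and a lies
   within distance q - p to the right of x, then b = x + q - a lies in [p, q],
   so phi a <= phi x + (phi q - inf_[p, q] phi); the infimum is finite because
   phi is midpoint convex and bounded above on [p, q].  Finitely many steps
   bound phi above on every segment of I.  Finally, the difference G between
   phi and its chord on a segment is midpoint convex and nonpositive at the
   endpoints; reflecting a point of the segment in its midpoint with the nearer
   endpoint gives 2 G <= sup G, hence sup G <= 0. *)
Require Import Defs.
From mathcomp Require Import all_boot all_order all_algebra.
From mathcomp Require Import all_classical all_reals all_analysis.
From mathcomp Require Import ring lra.

Set Implicit Arguments.
Unset Strict Implicit.
Unset Printing Implicit Defensive.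

Import Order.TTheory GRing.Theory Num.Theory.

Local Open Scope classical_set_scope.
Local Open Scope ring_scope.

(** Wright convexity: for fixed [h >= 0], the increment [phi (x + h) - phi x] is nondecreasing in
    [x]. Here [h = a - c] when [c] is the smallest point. *)
Definition wright_convex_on (R : realType) (I : set R) (phi : R -> R) : Prop :=
  forall a b c : R, I a -> I b -> I c -> I (a + b - c) ->
    (c <= a /\ c <= b) \/ (c >= a /\ c >= b) ->
    phi a + phi b <= phi c + phi (a + b - c).

Lemma convex_onP (R : realType) (I : set R) (phi : R -> R) :
  convex_on I phi <->
  forall x y t : R, I x -> I y -> 0 <= t <= 1 ->
    phi (t * x + (1 - t) * y) <= t * phi x + (1 - t) * phi y.
Proof.
split=> [cvx x y t Ix Iy /andP[t0 t1]|cvx t x y].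
  exact: (cvx (Itv01 t0 t1) x y (mem_set Ix) (mem_set Iy)).
rewrite !inE => Ix Iy; apply: cvx => //.
by apply/andP; split.
Qed.

(** With [d = a + b - c], the points [a] and [b] are convex combinations of [c] and [d] with swapped
    weights, so the two convexity inequalities add up to the claim. *)
Lemma convex_on_wright (R : realType) (I : set R) (phi : R -> R) :
  convex_on I phi -> wright_convex_on I phi.
Proof.
move=> /convex_onP cvx a b c Ia Ib Ic Id abc.
(* If [d = c], the order condition forces [a = b = c]; otherwise the weight [t] below can be
   formed. *)
have [cd|cd] := eqVneq (a + b - c) c.
  have -> : a = c by lra.
  have -> : b = c by lra.
  by rewrite addrK.
move: Id cd; have [d dE] : {d | d = a + b - c} by exists (a + b - c).
rewrite -dE => Id cd.
have dc0 : d - c != 0 by rewrite subr_eq0.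
(* This is the solution of [t * c + (1 - t) * d = a]. *)
pose t := (d - a) / (d - c).
have tE : t * (d - c) = d - a by rewrite /t divfK.
have t01 : 0 <= t <= 1.
  case: abc => -[ca cb].
    have ? : 0 < d - c by rewrite lt_def dc0; lra.
    by rewrite divr_ge0 ?ler_pdivrMr //; lra.
  have ? : 0 < c - d by rewrite lt_def -oppr_eq0 opprB dc0; lra.
  rewrite /t -[d - a]opprB -[d - c]opprB invrN mulrNN.
  by rewrite divr_ge0 ?ler_pdivrMr //; lra.
have := cvx c d t Ic Id t01; have := cvx d c t Id Ic t01.
have -> : t * d + (1 - t) * c = b by lra.
have -> : t * c + (1 - t) * d = a by lra.
lra.
Qed.

Lemma midpoint_convex_le0 (R : realType) (G : R -> R) (K : R) :
  G 0 <= 0 -> G 1 <= 0 ->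
  (forall u v, 0 <= u <= 1 -> 0 <= v <= 1 -> 2 * G ((u + v) / 2) <= G u + G v) ->
  (forall t, 0 <= t <= 1 -> G t <= K) ->
  forall t, 0 <= t <= 1 -> G t <= 0.
Proof.
move=> G0 G1 mid GK.
pose A := [set G t | t in [set t | 0 <= t <= 1]].
have Aub : has_ubound A by exists K => _ [t t01 <-]; exact: GK.
have Gsup t : 0 <= t <= 1 -> G t <= sup A.
  by move=> t01; apply: ub_le_sup => //; exists t.
have Ghalf t : 0 <= t <= 1 -> 2 * G t <= sup A.
  (* [t] is the midpoint of [0] and [2 * t], or of [1] and [2 * t - 1], whichever pair stays in the
     unit interval. *)
  move=> t01; have [t12|t12] := leP t (1 / 2).
    have /Gsup : 0 <= 2 * t <= 1 by lra.
    have := mid (2 * t) 0 ltac:(lra) ltac:(lra).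
    have -> : (2 * t + 0) / 2 = t by field.
    lra.
  have /Gsup : 0 <= 2 * t - 1 <= 1 by lra.
  have := mid (2 * t - 1) 1 ltac:(lra) ltac:(lra).
  have -> : (2 * t - 1 + 1) / 2 = t by field.
  lra.
have supA : sup A <= sup A / 2.
  apply: ge_sup; first by exists (G 0), 0 => //=; lra.
  by move=> _ [t /Ghalf ? <-]; lra.
by move=> t /Gsup ?; lra.
Qed.

Section WrightConvex.
Variables (R : realType) (I : set R) (phi : R -> R).
Hypotheses (Iitv : is_interval I) (wcvx : wright_convex_on I phi).

(** Take [a] and [b] both equal to the midpoint and [c = x]; the fourth point is then [y]. *)
Lemma wright_convex_midpoint (x y : R) : I x -> I y ->
  2 * phi ((x + y) / 2) <= phi x + phi y.
Proof.
wlog xy : x y / x <= y => [wl Ix Iy|Ix Iy].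
  have [/wl|/ltW/wl] := leP x y; first exact.
  by rewrite addrC [phi y + _]addrC; exact.
have Im : I ((x + y) / 2) by apply: (Iitv Ix Iy); lra.
have yE : (x + y) / 2 + (x + y) / 2 - x = y by field.
have := @wcvx _ _ x Im Im Ix.
by rewrite yE => /(_ Iy (or_introl _)) => /(_ ltac:(lra)); lra.
Qed.

(** Midpoint convexity is applied to [x] and its mirror image [p + q - x], where [phi] is at most
    [M]. *)
Lemma wright_convex_lower_bound (p q M : R) : I p -> I q ->
  (forall x, p <= x <= q -> phi x <= M) ->
  forall x, p <= x <= q -> 2 * phi ((p + q) / 2) - M <= phi x.
Proof.
move=> Ip Iq phiM x xpq.
have x'pq : p <= p + q - x <= q by lra.
have := wright_convex_midpoint (Iitv Ip Iq xpq) (Iitv Ip Iq x'pq).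
have -> : (x + (p + q - x)) / 2 = (p + q) / 2 by field.
by have := phiM _ x'pq; lra.
Qed.

Lemma wright_convex_transport (p q m x : R) : I x -> I q -> p < q ->
  (forall b, p <= b <= q -> m <= phi b) ->
  forall (n : nat) a, x <= a <= p -> a <= x + (q - p) * n%:R ->
    phi a <= phi x + (phi q - m) * n%:R.
Proof.
move=> Ix Iq pq phim; elim=> [|n IHn] a xap an.
  have -> : a = x by lra.
  lra.
have mq : m <= phi q by apply: phim; lra.
have n0 : 0 <= n%:R :> R by [].
rewrite -natr1 in an *.
(* [c] lies one step of length [q - p] to the left of [a], cut off at [x], so that the induction
   hypothesis bounds [phi c]. *)
have [c [xcp ca ac cn]] : exists c,
    [/\ x <= c <= p, c <= a, a <= c + (q - p) & c <= x + (q - p) * n%:R].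
  have [h|h] := leP a (x + (q - p)).
    by exists x; split; nra.
  by exists (a - (q - p)); split; lra.
have /IHn/(_ cn) phic := xcp.
have bpq : p <= c + q - a <= q by lra.
have dE : a + (c + q - a) - c = q by ring.
have Iin y : x <= y <= q -> I y := Iitv Ix Iq (z := y).
have Ia : I a by apply: Iin; lra.
have Ib : I (c + q - a) by apply: Iin; lra.
have Ic : I c by apply: Iin; lra.
have := wcvx Ia Ib Ic.
rewrite dE => /(_ Iq (or_introl _)) => /(_ ltac:(lra)).
by have := phim _ bpq; lra.
Qed.

Lemma wright_convex_bounded_left (p q M x : R) : I p -> I q -> I x -> p < q ->
  (forall x, p <= x <= q -> phi x <= M) ->
  exists K, forall a, x <= a <= q -> phi a <= K.
Proof.
move=> Ip Iq Ix pq phiM.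
have phim := wright_convex_lower_bound Ip Iq phiM.
set m := _ - M in phim.
have qp0 : 0 < q - p by lra.
(* Enough steps of length [q - p] to get from [x] to [p]. *)
pose n := Num.bound `|(p - x) / (q - p)|.
have pn : p - x <= (q - p) * n%:R.
  rewrite mulrC -ler_pdivrMr //; apply: le_trans (ler_norm _) _.
  by apply/ltW/archi_boundP.
exists (Num.max M (phi x + (phi q - m) * n%:R)) => a xaq.
rewrite le_max; have [pa|ap] := leP p a.
  by rewrite phiM //; lra.
apply/orP; right.
by apply: (wright_convex_transport Ix Iq pq phim); lra.
Qed.

End WrightConvex.

(** Reflection exchanges the two order alternatives. It turns extension of a bound to the left into
    extension to the right. *)
Lemma wright_convex_opp (R : realType) (I : set R) (phi : R -> R) :
  wright_convex_on I phi ->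
  wright_convex_on [set x | I (- x)] (fun x => phi (- x)).
Proof.
move=> wcvx a b c /= Ia Ib Ic Id abc.
have dE : - (a + b - c) = - a + - b - - c by ring.
rewrite dE in Id *; apply: wcvx => //.
by rewrite !lerN2; case: abc => ?; [right|left].
Qed.

Lemma wright_convex_bounded_above (R : realType) (I : set R) (phi : R -> R)
    (p q M x y : R) :
  is_interval I -> wright_convex_on I phi ->
  I p -> I q -> p < q -> (forall z, p <= z <= q -> phi z <= M) ->
  I x -> I y -> exists K, forall a, x <= a <= y -> phi a <= K.
Proof.
move=> Iitv wcvx Ip Iq pq phiM Ix Iy.
(* [K1] serves on [[x, q]] and [K2], found by reflection, on [[p, y]]; as [p < q], together they
   cover [[x, y]]. *)
have [K1 phiK1] := wright_convex_bounded_left Iitv wcvx Ip Iq Ix pq phiM.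
have NIitv : is_interval [set x | I (- x)].
  by move=> u v /= Iu Iv z uzv; apply: (Iitv _ _ Iv Iu); lra.
have [K2 phiK2] : exists K, forall a, - y <= a <= - p -> phi (- a) <= K.
  apply: (wright_convex_bounded_left (q := - p) (p := - q) (M := M) NIitv
    (wright_convex_opp wcvx)); rewrite /= ?opprK ?ltrN2 //.
  by move=> z zpq; apply: phiM; lra.
exists (Num.max K1 K2) => a xay; rewrite le_max.
have [aq|qa] := leP a q; first by rewrite phiK1 //; lra.
by rewrite -[a]opprK phiK2 ?orbT //; lra.
Qed.

Lemma wright_convex_on_convex (R : realType) (I J : set R) (phi : R -> R) :
  is_interval I -> nondegenerate_interval J -> J `<=` I ->
  bounded_above_on J phi -> wright_convex_on I phi -> convex_on I phi.
Proof.
move=> Iitv [Jitv [p [q [Jp Jq pq]]]] JI [M phiM] wcvx; apply/convex_onP.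
move=> x y t Ix Iy t01.
have {}phiM z : p <= z <= q -> phi z <= M.
  by move=> zpq; apply: phiM; exists z => //; exact: (Jitv _ _ Jp Jq).
have bnd u v := wright_convex_bounded_above (x := u) (y := v) Iitv wcvx
  (JI _ Jp) (JI _ Jq) pq phiM.
(* The order of [x] and [y] is not known, so a bound is taken for each order. *)
have [K1 phiK1] := bnd x y Ix Iy; have [K2 phiK2] := bnd y x Iy Ix.
pose chord (s : R) := s * phi x + (1 - s) * phi y.
pose G s := phi (s * x + (1 - s) * y) - chord s.
have Iseg s : 0 <= s <= 1 -> I (s * x + (1 - s) * y).
  move=> s01; have [xy|yx] := leP x y; first by apply: (Iitv _ _ Ix Iy); nra.
  by apply: (Iitv _ _ Iy Ix); nra.
suff : G t <= 0 by rewrite /G /chord; lra.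
(* The chord is nowhere below minus the sum of the absolute values of [phi x] and [phi y], which
   gives this upper bound for [G]. *)
apply: (@midpoint_convex_le0 _ G
  (Num.max K1 K2 + `|phi x| + `|phi y|)) => // {t t01}.
- by rewrite /G /chord !(mul0r, subr0, mul1r, add0r) subrr.
- by rewrite /G /chord !(mul0r, subrr, mul1r, addr0).
- move=> u v u01 v01.
  have := wright_convex_midpoint Iitv wcvx (Iseg u u01) (Iseg v v01).
  rewrite /G /chord.
  have -> : (u * x + (1 - u) * y + (v * x + (1 - v) * y)) / 2 =
            (u + v) / 2 * x + (1 - (u + v) / 2) * y by field.
  lra.
move=> s s01.
have phiK : phi (s * x + (1 - s) * y) <= Num.max K1 K2.
  rewrite le_max; have [xy|yx] := leP x y; first by rewrite phiK1 //; nra.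
  by rewrite phiK2 ?orbT //; nra.
have := ler_norm (- phi x); have := ler_norm (- phi y); rewrite !normrN.
have := normr_ge0 (phi x); have := normr_ge0 (phi y).
by rewrite /G /chord; nra.
Qed.

Theorem theorem2p1 (R : realType) (I : set R) (Iitv : is_interval I) :
  (forall phi : R -> R, convex_on I phi ->
     forall a b c : R, I a -> I b -> I c ->
       (c <= a /\ c <= b) \/ (c >= a /\ c >= b) ->
       I (a + b - c) ->
       phi a + phi b <= phi c + phi (a + b - c))
  /\
  (forall phi : R -> R,
     (exists J : set R,
        [/\ nondegenerate_interval J, J `<=` I & bounded_above_on J phi]) ->
     (convex_on I phi <->
      forall a b c : R, I a -> I b -> I c ->
        I (a + b - c) ->
        (c <= a /\ c <= b) \/ (c >= a /\ c >= b) ->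
        phi a + phi b <= phi c + phi (a + b - c))).
Proof.
split=> [phi cvx a b c Ia Ib Ic abc Id|phi [J [Jitv JI Jbnd]]].
  exact: (convex_on_wright cvx).
split; first exact: convex_on_wright.
exact: wright_convex_on_convex Iitv Jitv JI Jbnd.
Qed.
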